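(* Let $f:\mathbb{R}^d\to\mathbb{R}$ be twice differentiable with $L$-Lipschitz Hessian. Let $x,g\in\mathbb{R}^d$, let $H\in\mathbb{R}^{d\times d}$ be symmetric, let $M\ge L$, and let $x^+$ be a global minimizer of $y\mapsto \Omega_{M,g,H}(y,x)$. Then $$ f(x)-f(x^+)\;\ge\;\frac{1}{1008\sqrt{M}}\,\mu_M(x^+)+\frac{M\|x-x^+\|^3}{72}-\frac{4\|\nabla f(x)-g\|^{3/2}}{\sqrt{M}}-\frac{73\|\nabla^2 f(x)-H\|^3}{M^2}. $$
   Context: $\|\cdot\|$ is the Euclidean norm on vectors and the spectral norm $\|H\|=\max\{\lambda_{\max}(H),-\lambda_{\min}(H)\}$ on symmetric matrices. The Hessian of $f$ is $L$-Lipschitz means $\|\nabla^2 f(x)-\nabla^2 f(y)\|\le L\|x-y\|$ for all $x,y\in\mathbb{R}^d$. For $M>0$, $g\in\mathbb{R}^d$ and symmetric $H$, $\Omega_{M,g,H}(y,x):=\langle g,y-x\rangle+\frac12\langle H(y-x),y-x\rangle+\frac{M}{6}\|y-x\|^3$. For $c>0$, $\mu_c(x):=\max\Bigl\{\|\nabla f(x)\|^{3/2},\ \frac{(-\lambda_{\min}(\nabla^2 f(x)))^3}{c^{3/2}}\Bigr\}$. *)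

(* Defs.v *)
From HB Require Import structures.
From mathcomp Require Import all_boot all_order all_algebra.
From mathcomp Require Import all_classical all_reals all_analysis.
Set Implicit Arguments. Unset Strict Implicit. Unset Printing Implicit Defensive.
Import Order.TTheory GRing.Theory Num.Theory.
Import numFieldNormedType.Exports.
Local Open Scope classical_set_scope.
Local Open Scope ring_scope.

(* Euclidean inner product and Euclidean norm (the library norm on 'rV is the max norm). *)
Definition dotv (R : realType) (d : nat) (u v : 'rV[R]_d) : R :=
  \sum_(i < d) u 0 i * v 0 i.
Definition enorm (R : realType) (d : nat) (v : 'rV[R]_d) : R :=
  Num.sqrt (dotv v v).

(* Matrix acting on a vector: H v (v as a column), written with row vectors. *)
Definition matvec (R : realType) (d : nat) (H : 'M[R]_d) (v : 'rV[R]_d) : 'rV[R]_d :=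
  v *m H^T.

Definition lambda_min (R : realType) (d : nat) (H : 'M[R]_d) : R :=
  inf [set a : R | eigenvalue H a].
Definition lambda_max (R : realType) (d : nat) (H : 'M[R]_d) : R :=
  sup [set a : R | eigenvalue H a].

(* Spectral norm on symmetric matrices: max{lambda_max H, - lambda_min H}. *)
Definition specnorm (R : realType) (d : nat) (H : 'M[R]_d) : R :=
  Num.max (lambda_max H) (- lambda_min H).

(* Gradient (Frechet differential applied to the standard basis) and Hessian
   (Frechet differential of the gradient). Entry (i,j) of the Hessian is
   d/dx_i (d f / d x_j). *)
Definition grad (R : realType) (d : nat) (f : 'rV[R]_d -> R) (x : 'rV[R]_d) : 'rV[R]_d :=
  \row_(i < d) ('d f x (delta_mx 0 i)).
Definition hess (R : realType) (d : nat) (f : 'rV[R]_d -> R) (x : 'rV[R]_d) : 'M[R]_d :=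
  \matrix_(i < d, j < d) ('d (grad f) x (delta_mx 0 i) 0 j).

Definition twice_differentiable (R : realType) (d : nat) (f : 'rV[R]_d -> R) : Prop :=
  (forall x, differentiable f x) /\ (forall x, differentiable (grad f) x).

Definition hess_lipschitz (R : realType) (d : nat) (f : 'rV[R]_d -> R) (L : R) : Prop :=
  forall x y, specnorm (hess f x - hess f y) <= L * enorm (x - y).

Definition Omega (R : realType) (d : nat) (M : R) (g : 'rV[R]_d) (H : 'M[R]_d)
  (y x : 'rV[R]_d) : R :=
  dotv g (y - x) + 2^-1 * dotv (matvec H (y - x)) (y - x)
  + M / 6 * enorm (y - x) ^+ 3.

Definition mu (R : realType) (d : nat) (f : 'rV[R]_d -> R) (c : R) (x : 'rV[R]_d) : R :=
  Num.max (powR (enorm (grad f x)) (3 / 2))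
          ((- lambda_min (hess f x)) ^+ 3 / powR c (3 / 2)).

(* Main.v *)
Require Import Defs.
From HB Require Import structures.
From mathcomp Require Import all_boot all_order all_algebra.
From mathcomp Require Import all_classical all_reals all_analysis.
From mathcomp Require Import ring lra.
Import Order.TTheory GRing.Theory Num.Theory.
Import numFieldNormedType.Exports.
Local Open Scope ring_scope.

(* Write h = x+ - x, r = |h|, d1 = |grad f x - g| and d2 = |hess f x - H|. A global
   minimizer of the cubic model satisfies g + H h + (M/2) r h = 0 and
   H + (M/2) r I >= 0. Inserting both into the third-order Taylor bound for f gives
   f x - f x+ >= M r^3 / 12 - d1 r - d2 r^2 / 2, while the Taylor bound for the gradient
   and the Lipschitz bound for the Hessian give |grad f x+| <= M r^2 + d1 + d2 r and
   - lambda_min (hess f x+) <= (3/2) M r + d2. Young's inequality combines the three.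

   The spectral norm controls the quadratic form of a matrix only if it is symmetric,
   so Schwarz's theorem for twice Frechet differentiable functions is needed. *)

Section Euclid.
Set Implicit Arguments.
Unset Strict Implicit.
Local Open Scope classical_set_scope.
Context {R : realType} {d : nat}.
Implicit Types (u v w : 'rV[R]_d) (A B : 'M[R]_d).

(** * Euclidean inner product and norm *)

Lemma dotvC u v : dotv u v = dotv v u.
Proof. by apply: eq_bigr => i _; rewrite mulrC. Qed.
Lemma dotvDl u v w : dotv (u + v) w = dotv u w + dotv v w.
Proof. by rewrite -big_split; apply: eq_bigr => i _; rewrite mxE mulrDl. Qed.
Lemma dotvZl a u v : dotv (a *: u) v = a * dotv u v.
Proof. by rewrite /dotv mulr_sumr; apply: eq_bigr => i _; rewrite mxE mulrA. Qed.
Lemma dotvDr u v w : dotv u (v + w) = dotv u v + dotv u w.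
Proof. by rewrite dotvC dotvDl !(dotvC u). Qed.
Lemma dotvZr a u v : dotv u (a *: v) = a * dotv u v.
Proof. by rewrite dotvC dotvZl (dotvC u). Qed.
Lemma dotvNl u v : dotv (- u) v = - dotv u v.
Proof. by rewrite -scaleN1r dotvZl mulN1r. Qed.
Lemma dotvNr u v : dotv u (- v) = - dotv u v.
Proof. by rewrite dotvC dotvNl dotvC. Qed.
Lemma dotvBl u v w : dotv (u - v) w = dotv u w - dotv v w.
Proof. by rewrite dotvDl dotvNl. Qed.
Definition dotvE := (dotvDl, dotvDr, dotvNl, dotvNr, dotvZl, dotvZr).
Lemma dotv0l u : dotv 0 u = 0.
Proof. by rewrite -[0 in LHS](scale0r u) dotvZl mul0r. Qed.
Lemma dotvv_ge0 u : 0 <= dotv u u.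
Proof. by apply: sumr_ge0 => i _; rewrite -expr2 sqr_ge0. Qed.
Lemma dotvv_eq0 u : dotv u u = 0 -> u = 0.
Proof.
move=> /eqP; rewrite psumr_eq0 => [/allP u0|i _]; last by rewrite -expr2 sqr_ge0.
apply/rowP => i; rewrite mxE; apply/eqP.
by have := u0 i (mem_index_enum _); rewrite -expr2 sqrf_eq0.
Qed.
Lemma enorm_ge0 u : 0 <= enorm u.
Proof. exact: sqrtr_ge0. Qed.
Lemma sqr_enorm u : enorm u ^+ 2 = dotv u u.
Proof. by rewrite sqr_sqrtr ?dotvv_ge0. Qed.
Lemma enorm_eq0 u : enorm u = 0 -> u = 0.
Proof. by move=> u0; apply: dotvv_eq0; rewrite -sqr_enorm u0 expr0n. Qed.
Lemma enormZ a u : enorm (a *: u) = `|a| * enorm u.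
Proof. by rewrite /enorm !dotvE mulrA -expr2 sqrtrM ?sqr_ge0 // sqrtr_sqr. Qed.
Lemma enormN u : enorm (- u) = enorm u.
Proof. by rewrite -scaleN1r enormZ normrN1 mul1r. Qed.

(** Expand [0 <= |(|v| u - |u| v)|^2] and divide by [2 |u| |v|]; zero vectors are treated apart. *)
Lemma cauchy_schwarz u v : dotv u v <= enorm u * enorm v.
Proof.
have [u0|u0] := eqVneq (enorm u) 0.
  by rewrite u0 (enorm_eq0 u0) dotv0l mul0r.
have [v0|v0] := eqVneq (enorm v) 0.
  by rewrite v0 (enorm_eq0 v0) dotvC dotv0l mulr0.
have uv_gt0 : 0 < enorm u * enorm v by rewrite mulr_gt0 // lt_def ?u0 ?v0 enorm_ge0.
have := dotvv_ge0 (enorm v *: u - enorm u *: v).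
rewrite !dotvE -!sqr_enorm (dotvC v u) => uv_ge0.
rewrite -(ler_pM2l uv_gt0).
by nra.
Qed.

Lemma enormD u v : enorm (u + v) <= enorm u + enorm v.
Proof.
rewrite -(@ler_pXn2r _ 2) ?nnegrE ?addr_ge0 ?enorm_ge0 //.
rewrite sqr_enorm !dotvE -!sqr_enorm (dotvC v u).
by have := cauchy_schwarz u v; nra.
Qed.

(** * Action of matrices on vectors *)

Lemma matvecD A u v : matvec A (u + v) = matvec A u + matvec A v.
Proof. exact: mulmxDl. Qed.
Lemma matvecN A u : matvec A (- u) = - matvec A u.
Proof. exact: mulNmx. Qed.
Lemma matvecZ A a u : matvec A (a *: u) = a *: matvec A u.
Proof. by rewrite /matvec -scalemxAl. Qed.
Lemma matvecDl A B u : matvec (A + B) u = matvec A u + matvec B u.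
Proof. by rewrite /matvec linearD mulmxDr. Qed.
Lemma matvecNl A u : matvec (- A) u = - matvec A u.
Proof. by rewrite /matvec linearN mulmxN. Qed.
Definition matvecE := (matvecD, matvecN, matvecZ, matvecDl, matvecNl).
Lemma matvec_scalar a u : matvec a%:M u = a *: u.
Proof. by rewrite /matvec tr_scalar_mx mul_mx_scalar. Qed.

Lemma dotv_mulmx u v : dotv u v = (u *m v^T) 0 0.
Proof. by rewrite mxE; apply: eq_bigr => i _; rewrite mxE. Qed.

Lemma matvec_sym A u v : A^T = A -> dotv (matvec A u) v = dotv u (matvec A v).
Proof. by move=> AT; rewrite !dotv_mulmx /matvec !trmx_mul !trmxK AT mulmxA. Qed.

(** The limit [t -> 0+] in elementary form; the variational arguments below all end with it. *)
Lemma ge0_of_affine_ge0 (b c : R) :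
  (forall t, 0 < t -> t <= 1 -> 0 <= b + t * c) -> 0 <= b.
Proof.
move=> bc; rewrite leNgt; apply/negP => b0.
have c0 : 0 < 1 + `|c| by rewrite ltr_pwDl.
have b1 : 0 < 1 + `|b| by rewrite ltr_pwDl.
(* With this [t], [t |c| <= |b| / 2], so [b + t c <= b / 2 < 0]; the factor [1 + |b|] ensures
   [t <= 1]. *)
pose t := `|b| / (2 * ((1 + `|c|) * (1 + `|b|))).
have den : 0 < 2 * ((1 + `|c|) * (1 + `|b|)) by rewrite !mulr_gt0.
have t0 : 0 < t by rewrite divr_gt0 // normr_gt0 lt_eqF.
have cn := ler_norm c; have cn0 := normr_ge0 c; have bn0 := normr_ge0 b.
have bE : `|b| = - b by rewrite ltr0_norm.
have t1 : t <= 1 by rewrite ler_pdivrMr // mul1r; nra.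
have tE : t * (2 * ((1 + `|c|) * (1 + `|b|))) = `|b|.
  by rewrite /t divfK // gt_eqF.
have := bc t t0 t1.
have : t * (1 + `|c|) <= `|b| / 2.
  rewrite -tE; have : 0 <= t * (1 + `|c|) by rewrite mulr_ge0 // ltW.
  nra.
nra.
Qed.

(** [u] minimises the form, so its first variation vanishes: moving to [u - t w] with [w = A u]
    costs [- 2 t |w|^2 + t^2 <A w, w>], negative for small [t] unless [w = 0]. *)
Lemma psd_kernel A u : A^T = A -> (forall v, 0 <= dotv (matvec A v) v) ->
  dotv (matvec A u) u = 0 -> matvec A u = 0.
Proof.
move=> AT A_ge0 Au0; pose w := matvec A u.
apply: dotvv_eq0; apply: le_anti; rewrite dotvv_ge0 andbT -oppr_ge0 -/w.
have : 0 <= - dotv w w + - dotv w w; last by lra.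
apply: (ge0_of_affine_ge0 (c := (dotv (matvec A w) w))) => t t0 _.
have := A_ge0 (u + - t *: w).
rewrite !matvecE !dotvE Au0 (matvec_sym _ _ AT) -/w.
by rewrite (dotvC u) => h; rewrite -(pmulr_rge0 _ t0); lra.
Qed.

(** * Spectral bounds for symmetric matrices *)

Lemma differentiable_dotv (f g : 'rV[R]_d -> 'rV[R]_d) v :
  (forall i, differentiable (fun u => f u 0 i) v) ->
  (forall i, differentiable (fun u => g u 0 i) v) ->
  differentiable (fun u => dotv (f u) (g u)) v.
Proof.
move=> df dg; rewrite /dotv.
have -> : (fun u => \sum_(i < d) f u 0 i * g u 0 i) =
    \sum_(i < d) ((fun u => f u 0 i) * (fun u => g u 0 i)).
  by rewrite fct_sumE; apply/funext.
by apply: differentiable_sum => i; apply: differentiableM.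
Qed.

Lemma differentiable_dotvl w v : differentiable (fun u => dotv u w) v.
Proof.
apply: (@differentiable_dotv id (fun=> w)) => i; first exact: differentiable_coord.
exact: differentiable_cst.
Qed.

Lemma differentiable_quad A v : differentiable (fun u => dotv (matvec A u) u) v.
Proof.
apply: (@differentiable_dotv (matvec A) id) => i; last exact: differentiable_coord.
have -> : (fun u => matvec A u 0 i) = (fun u => dotv u (row i A)).
  by apply/funext => u; rewrite mxE; apply: eq_bigr => j _; rewrite !mxE.
exact: differentiable_dotvl.
Qed.

(** The sphere is a closed subset of the cube [[-1, 1]^d], a product of compact segments. *)
Lemma compact_sphere : compact [set v : 'rV[R]_d | dotv v v = 1].
Proof.
have box := @rV_compact R d (fun=> `[-1, 1]%classic) (fun=> @segment_compact _ _ _).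
refine (subclosed_compact _ box _).
- apply: (@preimage_closed _ _ (fun v : 'rV[R]_d => dotv v v) [set 1]); last exact: closed_eq.
  move=> v _; apply: differentiable_continuous.
  by apply: (@differentiable_dotv id id) => i; exact: differentiable_coord.
- move=> v /= v1 i; rewrite in_itv /= -ler_norml.
  rewrite -(@ler_pXn2r _ 2) ?nnegrE // expr1n real_normK ?num_real // -v1.
  rewrite /dotv (bigD1 i) //= expr2 lerDl.
  by apply: sumr_ge0 => j _; rewrite -expr2 sqr_ge0.
Qed.

(* [v] minimises the Rayleigh quotient on the unit sphere. *)
Lemma min_eigenvector A u : A^T = A -> u != 0 ->
  exists v a, [/\ v != 0, matvec A v = a *: v &
                  forall w, a * dotv w w <= dotv (matvec A w) w].
Proof.
move=> AT u0; pose q v := dotv (matvec A v) v.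
have scaled w : w != 0 -> dotv ((enorm w)^-1 *: w) ((enorm w)^-1 *: w) = 1.
  move=> w0; rewrite !dotvE -sqr_enorm mulrA -expr2 -exprMn mulVf ?expr1n //.
  by apply: contra_neq w0; exact: enorm_eq0.
have [||v] := EVT_min_rV _ compact_sphere (f := q).
- by exists ((enorm u)^-1 *: u); exact: scaled.
- apply: continuous_subspaceT => v; apply: differentiable_continuous.
  exact: differentiable_quad.
rewrite inE /= => v1 qv_min.
have qle w : q v * dotv w w <= dotv (matvec A w) w.
  have [->|w0] := eqVneq w 0.
    by rewrite (dotvC (matvec _ _)) !dotv0l mulr0.
  have := qv_min ((enorm w)^-1 *: w); rewrite inE /= => /(_ (scaled _ w0)).
  rewrite {2}/q !matvecE !dotvE mulrA -expr2 -sqr_enorm => le1.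
  have nw : 0 < enorm w ^+ 2.
    rewrite exprn_gt0 // lt_def enorm_ge0 andbT.
    by apply: contra_neq w0; exact: enorm_eq0.
  by rewrite -ler_pdivlMr // mulrC -exprVn.
exists v, (q v); split => //.
  by apply/eqP => v0; move: v1; rewrite v0 dotv0l => /eqP; rewrite eq_sym oner_eq0.
(* The form of [A - q(v) I] is nonnegative and vanishes at [v], so [v] lies in its kernel. *)
have : matvec (A - (q v)%:M) v = 0.
  apply: psd_kernel.
  - by rewrite linearB /= AT tr_scalar_mx.
  - by move=> w; rewrite !matvecE matvec_scalar !dotvE; have := qle w; lra.
  - by rewrite !matvecE matvec_scalar !dotvE v1 mulr1 /q subrr.
by rewrite !matvecE matvec_scalar => /eqP; rewrite subr_eq0 => /eqP.
Qed.

Lemma eigenvalue_matvec A a : A^T = A ->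
  eigenvalue A a <-> exists2 v, matvec A v = a *: v & v != 0.
Proof.
by move=> AT; rewrite /matvec AT; split=> [/eigenvalueP|?] //; apply/eigenvalueP.
Qed.

Lemma eigenvalue_lbound A a c : A^T = A ->
  (forall v, c * dotv v v <= dotv (matvec A v) v) -> eigenvalue A a -> c <= a.
Proof.
move=> AT cA /(eigenvalue_matvec _ AT)[v va v0].
have := cA v; rewrite va dotvE ler_pM2r //.
by rewrite lt_def dotvv_ge0 andbT; apply: contra_neq v0; exact: dotvv_eq0.
Qed.

Lemma lambda_min_quad A v : A^T = A -> lambda_min A * dotv v v <= dotv (matvec A v) v.
Proof.
move=> AT; have [->|v0] := eqVneq v 0.
  by rewrite (dotvC (matvec _ _)) !dotv0l mulr0.
have [u [a [u0 ua amin]]] := min_eigenvector AT v0.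
apply: le_trans (amin v); rewrite ler_wpM2r ?dotvv_ge0 //.
apply: ge_inf; last by apply/eigenvalue_matvec => //; exists u.
by exists a => b /=; apply: eigenvalue_lbound.
Qed.

Lemma le_lambda_min A c : A^T = A -> c <= 0 ->
  (forall v, c * dotv v v <= dotv (matvec A v) v) -> c <= lambda_min A.
Proof.
move=> AT c0 cA; rewrite /lambda_min.
have [E0|/set0P E0] := eqVneq [set a | eigenvalue A a] set0.
  (* An empty spectrum makes [lambda_min] the default value 0; this case uses [c <= 0]. *)
  by rewrite E0 inf0.
by apply: lb_le_inf => // a; apply: eigenvalue_lbound.
Qed.

(** Transfers the lower bounds to the top of the spectrum. Since [inf] is a negated [sup] of the
    negated set, only the eigenvalues of [A] and [- A] have to be matched. *)
Lemma lambda_maxN A : A^T = A -> lambda_max A = - lambda_min (- A).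
Proof.
move=> AT; have ANT : (- A)^T = - A by rewrite linearN /= AT.
rewrite /lambda_max /lambda_min /inf opprK; congr (sup _).
apply/seteqP; split=> a /=.
  move=> Aa; exists (- a); rewrite ?opprK //.
  move: Aa; rewrite /= !eigenvalue_matvec // => -[v va v0].
  by exists v; rewrite // !matvecE va scaleNr.
move=> [b Ab <-]; move: Ab; rewrite !eigenvalue_matvec // => -[v va v0].
by exists v; rewrite // -(opprK (matvec A v)) -matvecNl va scaleNr.
Qed.

Lemma specnorm_quad A v : A^T = A -> `|dotv (matvec A v) v| <= specnorm A * dotv v v.
Proof.
move=> AT; rewrite ler_norml; apply/andP; split.
  apply: le_trans (lambda_min_quad v AT); rewrite -mulNr ler_wpM2r ?dotvv_ge0 //.
  by rewrite lerNl le_max lexx orbT.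
have ANT : (- A)^T = - A by rewrite linearN /= AT.
have := lambda_min_quad v ANT; rewrite !matvecE dotvNl lerNr -mulNr => /le_trans; apply.
by rewrite ler_wpM2r ?dotvv_ge0 // le_max lambda_maxN // lexx.
Qed.

Lemma specnorm_ge0 A : A^T = A -> 0 <= specnorm A.
Proof.
move=> AT; have [E0|/set0P[a /(eigenvalue_matvec _ AT)[v _ v0]]] :=
  eqVneq [set a | eigenvalue A a] set0.
  by rewrite /specnorm /lambda_max /lambda_min E0 inf0 sup0 oppr0 maxxx.
have v_gt0 : 0 < dotv v v.
  by rewrite lt_def dotvv_ge0 andbT; apply: contra_neq v0; exact: dotvv_eq0.
rewrite -(pmulr_lge0 _ v_gt0); apply: le_trans (specnorm_quad v AT).
exact: normr_ge0.
Qed.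

(** Polarization: the quadratic bound at [u + v] and [u - v] gives
    [2 <A u, v> <= s (|u|^2 + |v|^2)]. This is applied to [|v| u] and [|u| v], which have equal
    norm. *)
Lemma specnorm_bilinear A u v : A^T = A ->
  dotv (matvec A u) v <= specnorm A * (enorm u * enorm v).
Proof.
move=> AT; set s := specnorm A.
have half u' v' : 2 * dotv (matvec A u') v' <= s * (dotv u' u' + dotv v' v').
  have := specnorm_quad (u' + v') AT; have := specnorm_quad (u' - v') AT.
  rewrite !ler_norml => /andP[+ _] /andP[_ +]; rewrite !matvecE !dotvE -/s.
  by rewrite (matvec_sym v' u' AT) (dotvC v' (matvec A u')) (dotvC v'); nra.
have [u0|u0] := eqVneq (enorm u) 0.
  by rewrite u0 (enorm_eq0 u0) matvec_sym // dotv0l mul0r mulr0.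
have [v0|v0] := eqVneq (enorm v) 0.
  by rewrite v0 (enorm_eq0 v0) dotvC dotv0l !mulr0.
have uv_gt0 : 0 < enorm u * enorm v by rewrite mulr_gt0 // lt_def ?u0 ?v0 enorm_ge0.
have := half (enorm v *: u) (enorm u *: v).
rewrite !matvecE !dotvE -!sqr_enorm => h.
rewrite -(ler_pM2l uv_gt0).
by nra.
Qed.

(** * Symmetry of the Hessian *)

Lemma is_derive_line (W : normedModType R) (F : 'rV[R]_d -> W) x h (t : R) :
  differentiable F (x + t *: h) ->
  is_derive t 1 (fun s => F (x + s *: h)) ('d F (x + t *: h) h).
Proof.
move=> dF.
have E : (fun k : R => k^-1 *: (((fun s => F (x + s *: h)) \o shift t) (k *: 1) - F (x + t *: h)))
       = (fun k => k^-1 *: ((F \o shift (x + t *: h)) (k *: h) - F (x + t *: h))).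
  apply/funext => k /=; congr (_ *: (F _ - _)).
  by rewrite -mulr_algl scaler1 mulr1 scalerDl addrCA.
split; first by rewrite /derivable E; exact: diff_derivable.
by rewrite -deriveE // /derive E.
Qed.

Lemma diff_gradE (f : 'rV[R]_d -> R) x h : 'd f x h = dotv (grad f x) h.
Proof.
rewrite {1}(row_sum_delta h) linear_sum; apply: eq_bigr => i _.
by rewrite linearZ mxE mulrC.
Qed.

Lemma is_derive_grad (f : 'rV[R]_d -> R) x h (t : R) :
  differentiable f (x + t *: h) ->
  is_derive t 1 (fun s => f (x + s *: h)) (dotv (grad f (x + t *: h)) h).
Proof. by rewrite -diff_gradE; exact: is_derive_line. Qed.

(** Rows of [hess] index the direction of differentiation, so it acts from the right, while [matvec]
    multiplies by the transpose; [hess_sym] reconciles the two. *)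
Lemma diff_hessE (f : 'rV[R]_d -> R) x h : 'd (grad f) x h = h *m hess f x.
Proof.
rewrite {1}(row_sum_delta h) linear_sum; apply/rowP => j.
rewrite summxE mxE; apply: eq_bigr => i _.
by rewrite linearZ !mxE.
Qed.

Lemma differentiable_gradv (f : 'rV[R]_d -> R) w a : differentiable (grad f) a ->
  differentiable (fun y => dotv (grad f y) w) a.
Proof.
move=> dg; apply: (@differentiable_comp _ _ _ _ (grad f) (fun u => dotv u w)) => //.
exact: differentiable_dotvl.
Qed.

Lemma diff_gradv (f : 'rV[R]_d -> R) w a h : differentiable (grad f) a ->
  'd (fun y => dotv (grad f y) w) a h = dotv (h *m hess f a) w.
Proof.
move=> dg; rewrite -diff_hessE.
have lin : linear (fun u => dotv u w) by move=> c u v; rewrite !dotvE.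
pose linM := GRing.isLinear.Build _ _ _ _ _ lin.
pose L : {linear 'rV[R]_d -> R} := HB.pack (fun u => dotv u w) linM.
have cL : continuous L by move=> u; exact/differentiable_continuous/differentiable_dotvl.
have -> : (fun y => dotv (grad f y) w) = L \o grad f by [].
have dL : differentiable L (grad f a) by exact: linear_differentiable.
by rewrite diff_comp //; rewrite [LHS]/comp diff_lin.
Qed.

(** The mean value theorem along [v] turns the second difference into [t] times a difference of
    [<grad f, v>] at two points near [x]; both values are then expanded to first order at [x]. *)
Lemma second_difference (f : 'rV[R]_d -> R) x u v (e : R) :
  twice_differentiable f -> 0 < e ->
  exists2 r, 0 < r & forall t, 0 < t -> t < r ->
  `|f (x + t *: u + t *: v) - f (x + t *: v) - (f (x + t *: u) - f x)
    - t ^+ 2 * dotv (u *m hess f x) v| <= e * t ^+ 2.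
Proof.
move=> [df dg] e0; pose G y := dotv (grad f y) v.
have dG y : differentiable G y by exact: differentiable_gradv.
(* The remainders are at most [(e / N) t (|u| + |v|)] and [(e / N) t |v|], together at most [e t];
   the summand 1 keeps [N] positive. *)
pose N := `|u| + 2 * `|v| + 1.
have N0 : 0 < N by rewrite /N ltr_wpDl // addr_ge0 // mulr_ge0.
have := diff_locallyx (dG x); set o := 'o _ => Gx.
have /(littleoP [littleo of o]) /nbhs_ballP[r r0 Hr] : 0 < e / N by rewrite divr_gt0.
have Hr' k : `|k| < r -> `|o k| <= e / N * `|k|.
  move=> kr; have : ball 0 r k by rewrite -ball_normE /= sub0r normrN.
  by move/Hr.
exists (r / N) => [|t t0 tr]; first by rewrite divr_gt0.
have tNr : t * N < r by rewrite -ltr_pdivlMr.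
pose phi (s : R) := f (x + t *: u + s *: v) - f (x + s *: v).
have dphi (s : R) : is_derive s 1 phi (G (x + t *: u + s *: v) - G (x + s *: v)).
  have d1 := is_derive_grad (df (x + t *: u + s *: v)).
  have d2 := is_derive_grad (df (x + s *: v)).
  exact: (is_deriveB d1 d2).
have [|c] := MVT t0 (fun s _ => dphi s).
  apply: continuous_subspaceT => s; apply: differentiable_continuous.
  by apply/derivable1_diffP; exact: ex_derive.
rewrite in_itv /= => /andP[c0 ct]; rewrite /phi !scale0r !addr0 subr0 => ->.
rewrite -addrA !(addrC x) !Gx.
rewrite !diff_gradv // mulmxDl -!scalemxAl !dotvE.
set a := dotv (u *m _) _; set b := dotv (v *m _) _.
(* The terms along [v] cancel, so the unknown mean value point [c] survives only in the
   remainders. *)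
have -> : (G x + (t *: a + c *: b) + o (t *: u + c *: v) - (G x + c *: b + o (c *: v))) * t
  - t ^+ 2 * a = (o (t *: u + c *: v) - o (c *: v)) * t.
  by rewrite /GRing.scale /=; ring.
have cv : `|c *: v| <= t * `|v| by rewrite normrZ gtr0_norm // ler_wpM2r // ltW.
have tucv : `|t *: u + c *: v| <= t * `|u| + t * `|v|.
  by apply: le_trans (ler_normD _ _) _; rewrite lerD // normrZ gtr0_norm.
have uv0 := normr_ge0 u; have vv0 := normr_ge0 v.
have h1 : `|o (t *: u + c *: v)| <= e / N * (t * `|u| + t * `|v|).
  apply: le_trans (Hr' _ _) _; last by rewrite ler_wpM2l // ltW ?divr_gt0.
  by apply: le_lt_trans tNr; apply: le_trans tucv _; rewrite /N; nra.
have h2 : `|o (c *: v)| <= e / N * (t * `|v|).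
  apply: le_trans (Hr' _ _) _; last by rewrite ler_wpM2l // ltW ?divr_gt0.
  by apply: le_lt_trans tNr; apply: le_trans cv _; rewrite /N; nra.
rewrite normrM (gtr0_norm t0) expr2 mulrA ler_wpM2r ?(ltW t0) //.
apply: le_trans (ler_normB _ _) _; apply: le_trans (lerD h1 h2) _.
rewrite -mulrDr -mulrA ler_wpM2l ?(ltW e0) // ler_pdivrMl //.
by rewrite /N; nra.
Qed.

(* Schwarz's theorem: both mixed derivatives are limits of the same symmetric second difference. *)
Lemma hess_sym (f : 'rV[R]_d -> R) x : twice_differentiable f -> (hess f x)^T = hess f x.
Proof.
move=> f2.
have sym u v : dotv (u *m hess f x) v = dotv (v *m hess f x) u.
  apply/eqP; rewrite -subr_eq0 -normr_le0; apply/ler_addgt0Pr => e e0; rewrite add0r.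
  have e2 : 0 < e / 2 by rewrite divr_gt0.
  have [r1 r10 H1] := second_difference x u v f2 e2.
  have [r2 r20 H2] := second_difference x v u f2 e2.
  pose t := Num.min r1 r2 / 2.
  have m0 : 0 < Num.min r1 r2 by rewrite lt_min r10.
  have t0 : 0 < t by rewrite divr_gt0.
  have tm : t < Num.min r1 r2 by rewrite /t; lra.
  have := H1 t t0; have := H2 t t0.
  move: tm; rewrite lt_min => /andP[-> ->] /(_ isT) + /(_ isT).
  rewrite (addrAC x (t *: v)) => h2 h1.
  have tt0 : 0 < t ^+ 2 by rewrite exprn_gt0.
  rewrite -(ler_pM2l tt0) -{1}(gtr0_norm tt0) -normrM.
  by move: h1 h2; rewrite !ler_norml; lra.
apply/matrixP => i j; rewrite mxE.
have E k l : hess f x k l = dotv (delta_mx 0 k *m hess f x) (delta_mx 0 l).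
  rewrite -rowE dotvC /dotv (bigD1 l) //= !mxE !eqxx mul1r big1 ?addr0 // => m ml.
  by rewrite mxE (negbTE ml) andbF mul0r.
by rewrite !E sym.
Qed.

(** * Taylor estimates *)

Lemma symB A B : A^T = A -> B^T = B -> (A - B)^T = A - B.
Proof. by move=> AT BT; rewrite linearB /= AT BT. Qed.

Lemma specnorm_bilinearB A B u v : A^T = A -> B^T = B ->
  dotv (matvec A u) v - dotv (matvec B u) v <= specnorm (A - B) * (enorm u * enorm v).
Proof.
move=> AT BT; rewrite -dotvBl -matvecNl -matvecDl.
exact/specnorm_bilinear/symB.
Qed.

(** Replaces integration of a derivative bound over [[0, 1]]: the mean value theorem for
    [phi - psi]. *)
Lemma diff_le_of_derive_le (phi psi dphi dpsi : R -> R) :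
  (forall t : R, is_derive t 1 phi (dphi t)) -> (forall t : R, is_derive t 1 psi (dpsi t)) ->
  (forall t, 0 < t -> dphi t <= dpsi t) -> phi 1 - phi 0 <= psi 1 - psi 0.
Proof.
move=> dp dq le_pq.
have dpq (t : R) : is_derive t 1 (phi - psi) (dphi t - dpsi t) by exact: is_deriveB.
have [|c] := MVT (ltr01 : 0 < 1 :> R) (fun t _ => dpq t).
  apply: continuous_subspaceT => s; apply: differentiable_continuous.
  by apply/derivable1_diffP; exact: ex_derive.
rewrite in_itv /= => /andP[c0 _].
rewrite -[(phi - psi) 1]/(phi 1 - psi 1) -[(phi - psi) 0]/(phi 0 - psi 0).
by have := le_pq c c0; lra.
Qed.

Lemma is_derive_cubic (a b c t : R) :
  is_derive t 1 (fun s => a * s + b * s ^+ 2 + c * s ^+ 3)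
                (a + 2 * b * t + 3 * c * t ^+ 2).
Proof.
have dp := is_deriveD (is_deriveD (is_deriveZ a (is_derive_id t 1))
  (is_deriveZ b (is_deriveX 2 (is_derive_id t 1))))
  (is_deriveZ c (is_deriveX 3 (is_derive_id t 1))).
apply: is_derive_eq dp _.
by rewrite /GRing.scale /=; ring.
Qed.

Lemma matvec_hess (f : 'rV[R]_d -> R) x h : twice_differentiable f ->
  matvec (hess f x) h = h *m hess f x.
Proof. by move=> f2; rewrite /matvec hess_sym. Qed.

Lemma is_derive_gradv (f : 'rV[R]_d -> R) w x h (t : R) : twice_differentiable f ->
  is_derive t 1 (fun s => dotv (grad f (x + s *: h)) w)
                (dotv (matvec (hess f (x + t *: h)) h) w).
Proof.
move=> f2; rewrite matvec_hess //; have [_ dg] := f2.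
rewrite -(diff_gradv w h (dg (x + t *: h))).
exact/(is_derive_line (F := fun y => dotv (grad f y) w))/differentiable_gradv.
Qed.

(** Testing against [w] reduces to a real function on the segment. Its derivative exceeds
    [<A h, w>], with [A] the Hessian at [x], by at most [M t |h|^2 |w|], the derivative of the
    quadratic term of the comparison polynomial. *)
Lemma grad_taylor (f : 'rV[R]_d -> R) M x y w :
  twice_differentiable f -> hess_lipschitz f M ->
  dotv (grad f y - grad f x - matvec (hess f x) (y - x)) w
    <= M / 2 * enorm (y - x) ^+ 2 * enorm w.
Proof.
move=> f2 fM; set h := y - x; have xh : x + h = y by rewrite addrC subrK.
have dphi (t : R) := is_derive_gradv w x h t f2.
have dpsi := is_derive_cubic (dotv (matvec (hess f x) h) w)
  (M / 2 * enorm h ^+ 2 * enorm w) 0.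
have := diff_le_of_derive_le dphi dpsi.
rewrite /= scale1r scale0r addr0 xh => le1.
have bound : dotv (grad f y) w - dotv (grad f x) w <=
    dotv (matvec (hess f x) h) w + M / 2 * enorm h ^+ 2 * enorm w; last first.
  by rewrite dotvBl dotvBl lerBlDr [leRHS]addrC.
apply: le_trans (le1 _) _; last by rewrite !expr1n !expr0n /= !mulr1 !mulr0 !addr0 subr0 lexx.
move=> t t0.
have le2 := specnorm_bilinearB h w (hess_sym (x + t *: h) f2) (hess_sym x f2).
have le3 : specnorm (hess f (x + t *: h) - hess f x) <= M * (t * enorm h).
  by apply: le_trans (fM _ _) _; rewrite addrC addKr enormZ gtr0_norm.
have hw : 0 <= enorm h * enorm w by rewrite mulr_ge0 ?enorm_ge0.
rewrite -addrA -lerBlDl; apply: le_trans le2 (le_trans (ler_wpM2r hw le3) _).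
by rewrite mulr0 mul0r; clear; lra.
Qed.

(** The derivative of [f] along the segment is bounded by [grad_taylor] at [x + t h], tested against
    [h]. *)
Lemma value_taylor (f : 'rV[R]_d -> R) M x y :
  twice_differentiable f -> hess_lipschitz f M ->
  f y - f x <= dotv (grad f x) (y - x)
    + 2^-1 * dotv (matvec (hess f x) (y - x)) (y - x) + M / 6 * enorm (y - x) ^+ 3.
Proof.
move=> f2 fM; set h := y - x; have xh : x + h = y by rewrite addrC subrK.
have [df _] := f2.
have dphi (t : R) := is_derive_grad (df (x + t *: h)).
have dpsi := is_derive_cubic (dotv (grad f x) h)
  (2^-1 * dotv (matvec (hess f x) h) h) (M / 6 * enorm h ^+ 3).
have := diff_le_of_derive_le dphi dpsi.
rewrite /= scale1r scale0r addr0 xh => le1.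
apply: le_trans (le1 _) _; last by rewrite !expr1n !expr0n /= !mulr1 !mulr0 !addr0 subr0 lexx.
move=> t t0; have := grad_taylor x (x + t *: h) h f2 fM.
rewrite dotvBl dotvBl lerBlDr lerBlDr => /le_trans; apply.
rewrite (_ : x + t *: h - x = t *: h); last by rewrite addrC addKr.
rewrite matvecZ enormZ gtr0_norm // (dotvZl t).
move: (dotv (matvec _ _) _) => b; move: (dotv _ _) => a; clear; lra.
Qed.

(** * Optimality conditions for the cubic model *)

Section CubicModel.
Variables (M : R) (g h : 'rV[R]_d) (H : 'M[R]_d).
Hypotheses (HT : H^T = H) (M_gt0 : 0 < M).
Let r := enorm h.
(** [Q] is the form of [H + (M/2) r I], and [p] is the differential at [h] of the cubic model. *)
Let Q v := dotv (matvec H v) v + M * r / 2 * dotv v v.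
Let p v := dotv g v + dotv (matvec H h) v + M * r / 2 * dotv h v.
Hypothesis h_min : forall k, dotv g h + 2^-1 * dotv (matvec H h) h + M / 6 * r ^+ 3 <=
  dotv g k + 2^-1 * dotv (matvec H k) k + M / 6 * enorm k ^+ 3.

(* From [b^3 - r^3 = 3/2 r (b^2 - r^2) + (b - r)^2 (b + r / 2)]. *)
Lemma cubic_model_gap w :
  0 <= p w + 2^-1 * Q w + M / 6 * ((enorm (h + w) - r) ^+ 2 * (enorm (h + w) + r / 2)).
Proof.
have := h_min (h + w); have := sqr_enorm (h + w); have := sqr_enorm h.
rewrite -/r; set b := enorm (h + w) => rE bE le1.
have -> : (b - r) ^+ 2 * (b + r / 2) = b ^+ 3 - r ^+ 3 - 3 / 2 * r * (b ^+ 2 - r ^+ 2) by field.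
have -> : b ^+ 2 - r ^+ 2 = 2 * dotv h w + dotv w w.
  by rewrite rE bE !dotvE (dotvC w h); ring.
move: le1; rewrite !matvecE !dotvE (matvec_sym w h HT) (dotvC w (matvec H h)) /p /Q.
by lra.
Qed.

(** By the triangle inequality [|h + t v|] differs from [r] by at most [t |v|], so the gap at [t v]
    is [t p v] plus a term of order [t^2]. Thus [p >= 0], and linearity gives equality. *)
Lemma cubic_model_first_order w : p w = 0.
Proof.
have p_ge0 v : 0 <= p v.
  pose c := 2^-1 * Q v + M / 6 * (enorm v ^+ 2 * (enorm v + 3 / 2 * r)).
  apply: (ge0_of_affine_ge0 (c := c)) => t t0 t1; rewrite -(pmulr_rge0 _ t0).
  apply: le_trans (cubic_model_gap (t *: v)) _.
  have -> : p (t *: v) = t * p v by rewrite /p !dotvE; ring.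
  have -> : Q (t *: v) = t ^+ 2 * Q v by rewrite /Q !matvecE !dotvE; ring.
  set b := enorm (h + t *: v).
  have nv := enorm_ge0 v; have nr : 0 <= r := enorm_ge0 h.
  have b1 : b <= r + t * enorm v.
    by apply: le_trans (enormD _ _) _; rewrite enormZ gtr0_norm.
  have b2 : r <= b + t * enorm v.
    have := enormD (h + t *: v) (- (t *: v)).
    by rewrite addrK enormN enormZ gtr0_norm.
  have b0 : 0 <= b by exact: enorm_ge0.
  have sq : (b - r) ^+ 2 <= (t * enorm v) ^+ 2.
    have tv : 0 <= t * enorm v by rewrite mulr_ge0 // ltW.
    by rewrite -(@ger0_norm _ (t * enorm v)) // -real_normK ?num_real //
       ler_pXn2r ?nnegrE // (ger0_norm tv) ler_norml; apply/andP; split; lra.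
  have lin : b + r / 2 <= enorm v + 3 / 2 * r by nra.
  have prod : (b - r) ^+ 2 * (b + r / 2) <= (t * enorm v) ^+ 2 * (enorm v + 3 / 2 * r).
    by apply: ler_pM => //; [exact: sqr_ge0|lra].
  have M6 : 0 <= M / 6 by rewrite divr_ge0 // ltW.
  have := ler_wpM2l M6 prod; rewrite /c; clear; move: (p v) (Q v) => pv qv; lra.
have := p_ge0 w; have := p_ge0 (- w).
rewrite /p !dotvE; lra.
Qed.

(* Every direction not orthogonal to [h] is a chord of the sphere of radius [r]
   through [h], along which the cubic term is constant; the others are limits. *)
Lemma cubic_model_second_order w : 0 <= Q w.
Proof.
have gap v : 0 <= Q v + M / 3 * ((enorm (h + v) - r) ^+ 2 * (enorm (h + v) + r / 2)).
  by have := cubic_model_gap v; rewrite cubic_model_first_order; lra.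
(* For [h = 0] the sphere degenerates; the gap at [t w] is [t^2 Q w] plus a multiple of [t^3]. *)
have [h0|h0] := eqVneq h 0.
  have r0 : r = 0 by rewrite /r h0 /enorm dotv0l sqrtr0.
  apply: (ge0_of_affine_ge0 (c := (M / 3 * enorm w ^+ 3))) => t t0 _.
  have := gap (t *: w); rewrite h0 add0r enormZ gtr0_norm // r0.
  have -> : Q (t *: w) = t ^+ 2 * Q w by rewrite /Q !matvecE !dotvE; ring.
  by move=> le1; rewrite -(pmulr_rge0 _ (exprn_gt0 2 t0)); lra.
have chord v : dotv v h != 0 -> 0 <= Q v.
  move=> vh; have v0 : 0 < dotv v v.
    rewrite lt_def dotvv_ge0 andbT; apply: contra_neq vh => /dotvv_eq0 ->.
    exact: dotv0l.
  (* The nonzero root of [|h + t v|^2 = r^2]. *)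
  pose t := - (2 * dotv v h) / dotv v v.
  have t0 : 0 < t ^+ 2.
    rewrite exprn_even_gt0 //= /t !mulf_eq0 oppr_eq0 mulf_eq0 invr_eq0 (gt_eqF v0).
    by rewrite pnatr_eq0 (negbTE vh).
  have sphere : enorm (h + t *: v) = r.
    rewrite /r /enorm; congr (Num.sqrt _); rewrite !dotvE (dotvC h v) /t.
    by field; rewrite gt_eqF.
  have := gap (t *: v); rewrite sphere subrr expr0n /= mul0r mulr0 addr0.
  have -> : Q (t *: v) = t ^+ 2 * Q v by rewrite /Q !matvecE !dotvE; ring.
  by rewrite pmulr_rge0.
have [wh|/chord//] := eqVneq (dotv w h) 0.
have hh : dotv h h != 0 by apply: contra_neq h0; exact: dotvv_eq0.
(* Here [w] is orthogonal to [h], but [w + t h] is not. The [Q h] in the constant absorbs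
   [t^2 Q h <= t Q h]. *)
apply: (ge0_of_affine_ge0 (c := (2 * (dotv (matvec H w) h + M * r / 2 * dotv w h) + Q h))) => t t0 t1.
have Qh : 0 <= Q h by exact: chord.
have Qwth : 0 <= Q (w + t *: h).
  by apply: chord; rewrite !dotvE wh add0r mulf_neq0 ?(gt_eqF t0).
apply: le_trans Qwth _.
have -> : Q (w + t *: h) = Q w + t * (2 * (dotv (matvec H w) h + M * r / 2 * dotv w h)) + t ^+ 2 * Q h.
  by rewrite /Q !matvecE !dotvE (matvec_sym h w HT) (dotvC h (matvec H w)) (dotvC h w); ring.
have tt : t ^+ 2 * Q h <= t * Q h by rewrite expr2 -mulrA ler_piMl // mulr_ge0 // ltW.
set B := 2 * (dotv (matvec H w) h + _).
by rewrite (mulrDr t B) addrA lerD2l.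
Qed.
End CubicModel.

(** * Combining the estimates *)

Lemma powR_three_halves (a : R) : 0 <= a -> powR a (3 / 2) = Num.sqrt a ^+ 3.
Proof.
by move=> a0; rewrite mulrC powRrM powR12_sqrt // powR_mulrn // sqrtr_ge0.
Qed.

(* In the variables [rho = s r], [a = sqrt d1], [e = d2 / s] (with [s = sqrt M]) all
   terms, multiplied by [s], become homogeneous of degree 3. *)
Lemma cubic_progress (s r d1 d2 gam lam D : R) :
  0 < s -> 0 <= r -> 0 <= d1 -> 0 <= d2 -> 0 <= gam ->
  s ^+ 2 / 12 * r ^+ 3 - d1 * r - 2^-1 * d2 * r ^+ 2 <= D ->
  gam <= s ^+ 2 * r ^+ 2 + d1 + d2 * r ->
  - lam <= 3 / 2 * s ^+ 2 * r + d2 ->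
  Num.max (powR gam (3 / 2)) ((- lam) ^+ 3 / powR (s ^+ 2) (3 / 2)) / (1008 * s)
    + s ^+ 2 * r ^+ 3 / 72 - 4 * powR d1 (3 / 2) / s - 73 * d2 ^+ 3 / (s ^+ 2) ^+ 2 <= D.
Proof.
move=> s0 r0 d10 d20 gam0 HD Hgam Hlam.
have ss0 : 0 <= s ^+ 2 by rewrite exprn_ge0 // ltW.
rewrite !powR_three_halves // sqrtr_sqr gtr0_norm //.
set a := Num.sqrt d1; set G := Num.sqrt gam.
pose rho := s * r; pose e := d2 / s.
have sN0 : s != 0 by rewrite gt_eqF.
have aE : d1 = a ^+ 2 by rewrite sqr_sqrtr.
have GE : gam = G ^+ 2 by rewrite sqr_sqrtr.
have a0 : 0 <= a by exact: sqrtr_ge0.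
have G0 : 0 <= G by exact: sqrtr_ge0.
have rE : r = rho / s by rewrite /rho mulrAC divff // mul1r.
have eE : d2 = e * s by rewrite /e divfK.
have rho0 : 0 <= rho by rewrite mulr_ge0 // ltW.
have e0 : 0 <= e by rewrite divr_ge0 // ltW.
have {}Hgam : G <= rho + a + e.
  rewrite -(@ler_pXn2r _ 2) ?nnegrE ?addr_ge0 // -GE.
  apply: le_trans Hgam _; rewrite aE eE rE.
  have -> : s ^+ 2 * (rho / s) ^+ 2 + a ^+ 2 + e * s * (rho / s) = rho ^+ 2 + a ^+ 2 + e * rho by field.
  by nra.
have {}Hlam : - lam / s <= 3 / 2 * rho + e.
  rewrite ler_pdivrMr //; apply: le_trans Hlam _; rewrite /rho eE.
  by lra.
(* The two cubes are at most [9 (rho^3 + a^3 + e^3)] and [4 ((27/8) rho^3 + e^3)]; 14 rounds up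
   [27/2]. *)
have bound : Num.max (G ^+ 3) ((- lam) ^+ 3 / s ^+ 3) <=
    14 * rho ^+ 3 + 9 * a ^+ 3 + 9 * e ^+ 3.
  have rho3 : 0 <= rho ^+ 3 by exact: exprn_ge0.
  have e3 : 0 <= e ^+ 3 by exact: exprn_ge0.
  have a3 : 0 <= a ^+ 3 by exact: exprn_ge0.
  rewrite ge_max; apply/andP; split.
    have : G ^+ 3 <= (rho + a + e) ^+ 3 by rewrite ler_pXn2r ?nnegrE ?addr_ge0.
    have c1 (x y : R) : 0 <= x -> 0 <= y -> x ^+ 2 * y + x * y ^+ 2 <= x ^+ 3 + y ^+ 3.
      by move=> x0 y0; have := mulr_ge0 (addr_ge0 x0 y0) (sqr_ge0 (x - y)); lra.
    have c3 : 6 * (rho * a * e) <= 2 * (rho ^+ 3 + a ^+ 3 + e ^+ 3).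
      have := mulr_ge0 (addr_ge0 (addr_ge0 rho0 a0) e0)
        (addr_ge0 (addr_ge0 (sqr_ge0 (rho - a)) (sqr_ge0 (a - e))) (sqr_ge0 (rho - e))).
      by lra.
    have := c1 _ _ rho0 a0; have := c1 _ _ rho0 e0; have := c1 _ _ a0 e0.
    by lra.
  rewrite -expr_div_n; have [l0|l0] := lerP (- lam / s) 0.
    apply: (@le_trans _ _ 0); last by lra.
    by rewrite exprS mulr_le0_ge0 // sqr_ge0.
  have X0 : 0 <= 3 / 2 * rho + e by lra.
  have : (- lam / s) ^+ 3 <= (3 / 2 * rho + e) ^+ 3 by rewrite ler_pXn2r ?nnegrE // ltW.
  have := mulr_ge0 (addr_ge0 (mulr_ge0 (ler0n R 3) rho0) (mulr_ge0 (ler0n R 2) e0))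
    (sqr_ge0 (3 * rho - 2 * e)).
  by lra.
(* Young's inequalities [a^2 rho <= rho^3 / 48 + (8/3) a^3] and [e rho^2 / 2 <= rho^3 / 36 + 24 e^3]
   in factored form. As [14/1008 = 1/72], the share of [rho^3] left is [1/12 - 2/72 = 1/18], above
   [1/48 + 1/36]. *)
have am1 := mulr_ge0 (sqr_ge0 (rho - 4 * a)) (addr_ge0 rho0 (mulr_ge0 (ler0n R 8) a0)).
have am2 := mulr_ge0 (sqr_ge0 (rho - 12 * e)) (addr_ge0 rho0 (mulr_ge0 (ler0n R 6) e0)).
apply: le_trans HD.
set m := Num.max _ _ in bound *.
rewrite -(ler_pM2l s0) aE eE rE.
have -> : s * (s ^+ 2 / 12 * (rho / s) ^+ 3 - a ^+ 2 * (rho / s) - 2^-1 * (e * s) * (rho / s) ^+ 2)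
   = rho ^+ 3 / 12 - a ^+ 2 * rho - 2^-1 * e * rho ^+ 2 by field.
have -> : s * (m / (1008 * s) + s ^+ 2 * (rho / s) ^+ 3 / 72 - 4 * a ^+ 3 / s - 73 * (e * s) ^+ 3 / (s ^+ 2) ^+ 2)
   = m / 1008 + rho ^+ 3 / 72 - 4 * a ^+ 3 - 73 * e ^+ 3 by field.
have e3 : 0 <= e ^+ 3 by exact: exprn_ge0.
have a3 : 0 <= a ^+ 3 by exact: exprn_ge0.
have rho3 : 0 <= rho ^+ 3 by exact: exprn_ge0.
by lra.
Qed.

Lemma enorm_le (u : 'rV[R]_d) c : dotv u u <= c * enorm u -> 0 <= c -> enorm u <= c.
Proof.
rewrite -sqr_enorm expr2; have [->//|u0] := eqVneq (enorm u) 0.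
by rewrite ler_pM2r // lt_def u0 enorm_ge0.
Qed.

(** The algebraic core: [G0], [A] stand for the gradient and Hessian at [x], [G1], [B] for those at
    [xp], [h] for [xp - x] and [D] for the decrease of [f]. *)
Lemma cubic_step_progress M (D r : R) (g G0 G1 h : 'rV[R]_d) A B H :
  r = enorm h -> 0 < M -> H^T = H -> A^T = A -> B^T = B ->
  (forall k, dotv g h + 2^-1 * dotv (matvec H h) h + M / 6 * enorm h ^+ 3 <=
    dotv g k + 2^-1 * dotv (matvec H k) k + M / 6 * enorm k ^+ 3) ->
  - D <= dotv G0 h + 2^-1 * dotv (matvec A h) h + M / 6 * enorm h ^+ 3 ->
  (forall w, dotv (G1 - G0 - matvec A h) w <= M / 2 * enorm h ^+ 2 * enorm w) ->
  specnorm (A - B) <= M * r ->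
  Num.max (powR (enorm G1) (3 / 2)) ((- lambda_min B) ^+ 3 / powR M (3 / 2))
      / (1008 * Num.sqrt M)
    + M * r ^+ 3 / 72 - 4 * powR (enorm (G0 - g)) (3 / 2) / Num.sqrt M
    - 73 * specnorm (A - H) ^+ 3 / M ^+ 2 <= D.
Proof.
move=> -> M0 HT AT BT h_min value slope lip.
have foc := cubic_model_first_order HT M0 h_min.
have soc := cubic_model_second_order HT M0 h_min.
have AHT := symB AT HT; have ABT := symB AT BT.
have sM : Num.sqrt M ^+ 2 = M by rewrite sqr_sqrtr // ltW.
have hh : dotv h h = enorm h ^+ 2 by rewrite sqr_enorm.
have := @cubic_progress (Num.sqrt M) (enorm h) (enorm (G0 - g)) (specnorm (A - H))
  (enorm G1) (lambda_min B) D.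
rewrite sM; apply; rewrite ?sqrtr_gt0 ?enorm_ge0 ?specnorm_ge0 //.
(* The two conditions at [h] give [<g, h> + <H h, h> / 2 <= - M r^3 / 4]; adding the cubic term
   [M r^3 / 6] leaves [- M r^3 / 12]. *)
- have := foc h; have := soc h; rewrite hh => soc_h foc_h.
  have := cauchy_schwarz (G0 - g) h; rewrite dotvBl => cs.
  have := specnorm_bilinearB h h AT HT; rewrite -expr2 => AH_h.
  move: value soc_h foc_h cs AH_h; clear -M0.
  move: (dotv G0 h) (dotv g h) (dotv (matvec A h) h) (dotv (matvec H h) h).
  move: (enorm (G0 - g)) (specnorm (A - H)) (enorm h) => d1 d2 r a b u v.
  by lra.
(* Everything is tested against [G1]. The Taylor remainder and [g + H h = - (M/2) r h] each
   contribute [(M/2) r^2]. *)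
- apply: enorm_le; last first.
    by rewrite !addr_ge0 ?mulr_ge0 ?sqr_ge0 ?enorm_ge0 ?specnorm_ge0 // ltW.
  have := slope G1; rewrite dotvBl dotvBl => slope1.
  have := foc G1 => foc1.
  have := cauchy_schwarz (G0 - g) G1; rewrite dotvBl => cs1.
  have := specnorm_bilinearB h G1 AT HT => AH1.
  have := cauchy_schwarz (- h) G1; rewrite dotvNl enormN => cs2.
  have Mr : 0 <= M / 2 * enorm h by rewrite mulr_ge0 ?enorm_ge0 // divr_ge0 // ltW.
  have := ler_wpM2l Mr cs2.
  move: slope1 foc1 cs1 AH1; clear -M0.
  move: (dotv G1 G1) (dotv G0 G1) (dotv g G1) (dotv h G1) (dotv (matvec A h) G1) (dotv (matvec H h) G1).
  move: (enorm (G0 - g)) (specnorm (A - H)) (enorm h) (enorm G1) => d1 d2 r w a b c e u v.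
  by lra.
(* As forms, [B >= A - M r I >= H - (d2 + M r) I >= - ((3/2) M r + d2) I], where [d2] is the
   spectral norm of [A - H]. *)
- rewrite lerNl; apply: le_lambda_min => //.
    by rewrite oppr_le0 !addr_ge0 ?mulr_ge0 ?enorm_ge0 ?specnorm_ge0 ?(ltW M0) // ler0n.
  move=> v; have := soc v => soc_v.
  have := specnorm_quad v AHT; have := specnorm_quad v ABT.
  rewrite !matvecDl !matvecNl !dotvBl !ler_norml => /andP[_ AB_v] /andP[AH_v _].
  have := ler_wpM2r (dotvv_ge0 v) lip.
  move: soc_v AB_v AH_v; clear -M0.
  move: (dotv v v) (dotv (matvec A v) v) (dotv (matvec B v) v) (dotv (matvec H v) v).
  move: (specnorm (A - H)) (specnorm (A - B)) (enorm h) => d2 d3 r n a b c.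
  by lra.
Qed.

End Euclid.

Theorem mainTheorem1 (R : realType) (d : nat) (f : 'rV[R]_d -> R) (L M : R)
  (x g xp : 'rV[R]_d) (H : 'M[R]_d) :
  twice_differentiable f ->
  hess_lipschitz f L ->
  H^T = H ->
  0 < M -> L <= M ->
  (forall y : 'rV[R]_d, Omega M g H xp x <= Omega M g H y x) ->
  f x - f xp >=
    mu f M xp / (1008 * Num.sqrt M)
    + M * enorm (x - xp) ^+ 3 / 72
    - 4 * powR (enorm (grad f x - g)) (3 / 2) / Num.sqrt M
    - 73 * specnorm (hess f x - H) ^+ 3 / M ^+ 2.
Proof.
move=> f2 fL HT M0 LM xp_min.
have fM : hess_lipschitz f M.
  by move=> y z; apply: le_trans (fL y z) _; rewrite ler_wpM2r ?enorm_ge0.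
have xE : enorm (x - xp) = enorm (xp - x) by rewrite -enormN opprB.
rewrite /mu; apply: (cubic_step_progress xE M0 HT (hess_sym x f2) (hess_sym xp f2)).
- by move=> k; have := xp_min (x + k); rewrite /Omega [x + k - x]addrC addKr.
- by rewrite opprB; exact: value_taylor.
- by move=> w; exact: grad_taylor.
- exact: fM.
Qed.
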